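(* For all integers $r\ge 2$, $k\ge 1$, $t\ge 1$, $$\chi(M_k^r,t)\le (t-1)(k-1)+2k.$$ Equality holds for $r=2$.
   Context: Hypergraphs $H=(V,E)$ are finite: $V$ is a nonempty finite set of vertices and $E$ is a set of subsets of $V$ (edges), each of size at least $2$; $H$ is $r$-uniform if all edges have size $r$. The edge set of a hypergraph being colored is allowed to be empty. A $k$-coloring $c:V\to\{1,\dots,k\}$ is proper if no edge is monochromatic; the chromatic number $\chi(H)$ is the least $m\ge 1$ such that $H$ has a proper $m$-coloring, and then $H$ is called $m$-chromatic. $M_k^r$ denotes the $r$-uniform matching with $k$ edges: $k$ pairwise disjoint edges of size $r$, every vertex belonging to some edge. A $t$-edge-coloring of $H=(V,E)$ is a partition $E=E_1\cup\dots\cup E_t$ into $t$ pairwise disjoint (possibly empty) color classes. A monochromatic copy of $T$ is a (not necessarily induced) subhypergraph isomorphic to $T$ all of whose edges lie in one class $E_i$. For an acyclic $r$-uniform hypergraph $T$ (such as $M_k^r$), the ($t$-color) chromatic Ramsey number $\chi(T,t)$ is the smallest positive integer $m$ such that under any $t$-edge-coloring of any $m$-chromatic $r$-uniform hypergraph there is a monochromatic copy of $T$. An upper bound on $\chi(T,t)$ includes the assertion that such an $m$ exists. *)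

(* Defs.v *)
From mathcomp Require Import all_boot.

Set Implicit Arguments.
Unset Strict Implicit.
Unset Printing Implicit Defensive.

Record hypergraph := Hypergraph {
  vertex :> finType;
  edges : {set {set vertex}};
  vertex_nonempty : 1 <= #|vertex|;
  edges_ge2 : forall e, e \in edges -> 2 <= #|e| }.

Definition uniform (r : nat) (H : hypergraph) : Prop :=
  forall e, e \in edges H -> #|e| = r.

Definition least (P : nat -> Prop) (m : nat) : Prop :=
  P m /\ forall n, P n -> m <= n.

Definition monochromatic (H : hypergraph) (C : Type) (c : H -> C)
    (e : {set H}) : Prop :=
  exists a : C, forall x, x \in e -> c x = a.

Definition proper_coloring (H : hypergraph) (m : nat) (c : H -> 'I_m) : Prop :=
  forall e, e \in edges H -> ~ monochromatic c e.

Definition colorable (H : hypergraph) (m : nat) : Prop :=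
  exists c : H -> 'I_m, proper_coloring c.

(* [chromatic H m] is "chi(H) = m", i.e. H is m-chromatic. *)
Definition chromatic (H : hypergraph) (m : nat) : Prop :=
  least (fun n => 1 <= n /\ colorable H n) m.

Definition edge_coloring (H : hypergraph) (t : nat)
    (E : 'I_t -> {set {set H}}) : Prop :=
  \bigcup_i E i = edges H /\ forall i j, i != j -> [disjoint E i & E j].

(* The copy of T is the subhypergraph of H with vertex set [f @: T] and edge
   set [[set f @: e | e in edges T]]. *)
Definition monochromatic_copy (T H : hypergraph) (t : nat)
    (E : 'I_t -> {set {set H}}) : Prop :=
  exists (i : 'I_t) (f : T -> H),
    injective f /\ [set f @: (e : {set T}) | e in edges T] \subset E i.

Definition ramsey_property (r : nat) (T : hypergraph) (t m : nat) : Prop :=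
  forall H : hypergraph, uniform r H -> chromatic H m ->
  forall E : 'I_t -> {set {set H}}, edge_coloring E ->
  monochromatic_copy T E.

(* [chromatic_ramsey r T t m] is "chi(T, t) exists and equals m", for T an
   r-uniform hypergraph.  It is a relation because the smallest such m need
   not exist for an arbitrary T. *)
Definition chromatic_ramsey (r : nat) (T : hypergraph) (t m : nat) : Prop :=
  least (fun n => 1 <= n /\ ramsey_property r T t n) m.

Section Matching.

Variables (r k : nat) (r_ge2 : 2 <= r) (k_ge1 : 1 <= k).

Definition matching_edge (i : 'I_k) : {set 'I_k * 'I_r} :=
  [set x | x.1 == i].

Definition matching_edges : {set {set 'I_k * 'I_r}} :=
  [set matching_edge i | i : 'I_k].

Lemma card_matching_edge i : #|matching_edge i| = r.
Proof.
have -> : matching_edge i = setX [set i] [set: 'I_r].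
  by apply/setP=> x; rewrite !inE andbT.
by rewrite cardsX cards1 cardsT card_ord mul1n.
Qed.

Fact matching_nonempty : 1 <= #|{: 'I_k * 'I_r}|.
Proof. by rewrite card_prod !card_ord muln_gt0 k_ge1 ltnW. Qed.

Fact matching_ge2 (e : {set 'I_k * 'I_r}) : e \in matching_edges -> 2 <= #|e|.
Proof. by case/imsetP=> i _ ->; rewrite card_matching_edge. Qed.

(* M_k^r: the vertices are the pairs in 'I_k * 'I_r, and the i-th edge is
   {i} x 'I_r. *)
Definition matching : hypergraph := Hypergraph matching_nonempty matching_ge2.

Lemma matchingP :
  [/\ uniform r matching, #|edges matching| = k, trivIset (edges matching)
    & cover (edges matching) = setT].
Proof.
have inj : injective matching_edge.
  move=> i j eij; have x0 : 'I_r by exists 0; exact: ltnW.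
  by have := in_set (fun x => x.1 == j) (i, x0);
     rewrite -/(matching_edge j) -eij inE eqxx => /esym/eqP.
split.
- by move=> e /imsetP[i _ ->]; exact: card_matching_edge.
- by rewrite card_imset // card_ord.
- apply/trivIsetP=> _ _ /imsetP[i _ ->] /imsetP[j _ ->] neq.
  apply/pred0P=> x /=; rewrite !inE; apply/negP=> /andP[/eqP xi /eqP xj].
  by case/negP: neq; rewrite -xi -xj.
- apply/setP=> x; rewrite inE; apply/bigcupP.
  by exists (matching_edge x.1); rewrite ?inE //; apply/imsetP; exists x.1.
Qed.

End Matching.

(* Main.v *)
Require Import Defs.
From mathcomp Require Import all_boot zify.
From Stdlib Require Import Classical.

Set Implicit Arguments.
Unset Strict Implicit.
Unset Printing Implicit Defensive.

(** Upper bound.  Let [m = (t - 1)(k - 1) + 2k] and take a proper [m]-coloring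
    of an [m]-chromatic hypergraph [H].  Merging two color classes [a] and [b]
    must destroy properness, so some edge of [H] has color set exactly [{a, b}]
    ([chromatic_class_pair_edge]).  Giving the pair [{a, b}] the colors of all
    such edges turns the color classes into the vertices of a [t]-colored
    complete graph [K_m], and disjoint pairs of classes come from disjoint edges
    of [H].  It is therefore enough to find a monochromatic matching with [k]
    edges in [K_m], which is the theorem of Cockayne and Lorimer
    ([cockayne_lorimer]).

    That theorem is proved in the form: if color [i] has no matching with more
    than [n_i] edges and [n_i <= K] for all [i], then the number of vertices is
    at most [K + 1] plus the sum of the [n_i].  If some vertex can be deleted so
    that a color [i] has no matching of size [n_i] left, induct with [n_i]
    lowered: the vertex count and the sum both drop by one.  Otherwise, in every
    color, each vertex is missed by some maximum matching.  By Gallai's lemma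
    ([gallai_partition]) the edges of color [i] then lie inside the blocks of a
    partition [P_i] of the vertices such that a maximum matching misses at most
    one vertex of each block.  What remains is a double count on partitions that
    together cover all pairs ([covering_partitions_bound]).

    Lower bound for [r = 2].  If [n < m], color the edges of [K_n] by their
    larger endpoint [z]: color 0 if [z < 2k - 1], and otherwise according to
    consecutive intervals of length [k - 1].  Color 0 lives on [2k - 1] vertices,
    and in any other color a matching has at most [k - 1] edges because their
    larger endpoints are distinct ([ramsey_property_matching2_ge]). *)

(** * Matchings in graphs and Gallai's lemma *)

Definition is_matching (T : finType) (E M : {set {set T}}) : bool :=
  (M \subset E) && trivIset M.

Definition is_matching_of_size (T : finType) (E : {set {set T}}) (n : nat)
  (M : {set {set T}}) : bool := is_matching E M && (#|M| == n).

Lemma disjoint_set2 (T : finType) (x y : T) (A : {set T}) :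
  [disjoint [set x; y] & A] = (x \notin A) && (y \notin A).
Proof. by rewrite disjoints_subset subUset !sub1set !inE. Qed.

Section Gallai.

Variables (T : finType) (E : {set {set T}}) (n : nat).
Hypothesis card_edge : forall e, e \in E -> #|e| = 2.
Hypothesis matching_bound : forall M, is_matching E M -> #|M| <= n.

Lemma edges_meet_eq M e f x :
  is_matching E M -> e \in M -> f \in M -> x \in e -> x \in f -> e = f.
Proof.
case/andP=> _ /trivIsetP trM eM fM xe xf; apply/eqP/negPn/negP=> ef.
by move: (trM _ _ eM fM ef) => /pred0P/(_ x); rewrite /= xe xf.
Qed.

Lemma card_cover_matching M : is_matching E M -> #|cover M| = 2 * #|M|.
Proof.
case/andP=> /subsetP sM /eqP <-.
rewrite (eq_bigr (fun=> 2)) => [|e /sM /card_edge //].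
by rewrite sum_nat_const mulnC.
Qed.

Lemma is_matchingU1 e M : is_matching E M -> e \in E -> [disjoint e & cover M] ->
  is_matching E (e |: M) /\ e \notin M.
Proof.
move=> mM eE eM; have [sM trM] := andP mM.
have dis : {in M, forall f : {set T}, [disjoint e & f]}.
  by move=> f fM; apply: disjointWr eM; exact: bigcup_sup fM.
have n0 : set0 \notin M.
  by apply/negP=> /(subsetP sM) /card_edge; rewrite cards0.
have [tr eN] := trivIsetU1 dis trM n0; split=> //.
by rewrite /is_matching tr subUset sub1set eE sM.
Qed.

Lemma is_matchingS (M N : {set {set T}}) :
  is_matching E M -> N \subset M -> is_matching E N.
Proof.
case/andP=> sM trM NM; apply/andP; split; first exact: subset_trans sM.
exact: trivIsetS trM.
Qed.

(** The exchange step behind Gallai's lemma: missing a common maximum matching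
    is a relation whose complement is transitive.  Among the maximum matchings
    missing [w], take [N] sharing as many edges as possible with [M].  If [N]
    covered both [u] and [v], then, [M] and [N] having equal size, [M] would
    cover a vertex [x] other than [w] that [N] misses; exchanging the [N]-edge at
    the [M]-partner [y] of [x] for [{x, y}] would give a better [N]. *)
Lemma missed_pair_split M u v w :
  is_matching_of_size E n M -> u != v -> u \notin cover M -> v \notin cover M ->
  (exists2 N, is_matching_of_size E n N & w \notin cover N) ->
  exists2 N, is_matching_of_size E n N &
    (w \notin cover N) && ((u \notin cover N) || (v \notin cover N)).
Proof.
move=> szM uv uM vM [N0 szN0 wN0].
pose P N := is_matching_of_size E n N && (w \notin cover N).
have PN0 : P N0 by rewrite /P szN0.
case: (@arg_maxnP _ N0 P (fun N => #|M :&: N|) PN0) => N /andP[szN wN] maxN.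
case uN: (u \in cover N); last by exists N; rewrite ?wN ?uN.
case vN: (v \in cover N); last by exists N; rewrite ?wN ?vN ?orbT.
case/boolP: (w \in cover M) => [wM|wM]; last by exists M; rewrite ?wM ?uM.
have [mM /eqP cM] := andP szM; have [mN /eqP cN] := andP szN.
(* [u] and [v] lie in [cover N :\: cover M], so the equally large difference
   [cover M :\: cover N] has a vertex besides [w]. *)
have [x /setDP[xM xN] xw] : exists2 x, x \in cover M :\: cover N & x != w.
  have le2 : 1 < #|cover M :\: cover N|.
    have -> : #|cover M :\: cover N| = #|cover N :\: cover M|.
      rewrite !cardsD setIC (card_cover_matching mM) (card_cover_matching mN).
      by rewrite cM cN.
    rewrite -(_ : #|[set u; v]| = 2); last by rewrite cards2 uv.
    apply/subset_leq_card/subsetP=> z; rewrite !inE.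
    by case/orP=> /eqP->; rewrite ?uN ?vN ?uM ?vM.
  have : 0 < #|(cover M :\: cover N) :\ w|.
    move: le2; rewrite (cardsD1 w); case: (w \in _); first by rewrite add1n ltnS.
    exact: ltnW.
  by case/card_gt0P=> x /setD1P[xw xMN]; exists x.
have [e eM xe] := bigcupP xM.
have eE : e \in E by apply: (subsetP (andP mM).1).
have [y yx eD] : exists2 y, y != x & e = [set x; y].
  have := card_edge eE => /eqP /cards2P[a [b [ab eab]]].
  move: xe; rewrite eab !inE => /orP[]/eqP->; first by exists b; rewrite // eq_sym.
  by exists a => //; rewrite setUC.
have yN : y \in cover N.
  apply/negPn/negP=> yN.
  have [|m' eN] := is_matchingU1 mN eE.
    by rewrite eD disjoint_set2 ?xN ?yN.
  by have := matching_bound m'; rewrite cardsU1 eN cN ltnn.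
have [g gN yg] := bigcupP yN.
have mNg : is_matching E (N :\ g) by apply: is_matchingS mN (subsetDl _ _).
have coverNg z : z \in cover (N :\ g) -> z \in cover N.
  by case/bigcupP=> f /setD1P[_ fN] zf; apply/bigcupP; exists f.
have [|mN' eNg] := is_matchingU1 mNg eE.
  rewrite eD disjoint_set2; apply/andP; split.
    by apply: contra xN => /coverNg.
  apply/negP=> /bigcupP[f /setD1P[/eqP fg fN] yf].
  by apply: fg; apply: edges_meet_eq mN fN gN yf yg.
have PN' : P (e |: N :\ g).
  rewrite /P /is_matching_of_size mN' cardsU1 eNg.
  have := cardsD1 g N; rewrite gN cN => <- /=; rewrite eqxx /=.
  apply/negP=> /bigcupP[f /setU1P[->|fN] wf].
    move: wf; rewrite eD !inE eq_sym (negPf xw) /= => /eqP wy.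
    by rewrite wy yN in wN.
  by case/negP: wN; apply: coverNg; apply/bigcupP; exists f.
have gM : g \notin M.
  apply/negP=> gM; case/negP: xN; apply/bigcupP; exists g => //.
  suff <- : e = g by [].
  by apply: edges_meet_eq mM eM gM _ yg; rewrite eD !inE eqxx orbT.
have eN : e \notin N.
  by apply: contra xN => eN; apply/bigcupP; exists e.
suff : #|M :&: (e |: N :\ g)| = #|M :&: N|.+1.
  by move=> more; have := maxN _ PN'; rewrite /= more ltnn.
have -> : M :&: (e |: N :\ g) = e |: (M :&: N).
  apply/setP=> f; rewrite !inE; case: (eqVneq f e) => [->|fe]; first by rewrite eM.
  by case: (eqVneq f g) => [->|] //=; rewrite (negPf gM).
by rewrite cardsU1 !inE (negPf eN) andbF.
Qed.

(** If every vertex is missed by some maximum matching, the classes of this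
    relation turn out to be the connected components of the graph, which are
    then factor-critical.  Defining them through matchings rather than through
    paths makes the bound on missed vertices immediate and puts the work into
    transitivity. *)
Definition inseparable (u v : T) : bool :=
  (u == v) || ~~ [exists M, is_matching_of_size E n M &&
                    ((u \notin cover M) && (v \notin cover M))].

Variable A : {set T}.
Hypothesis all_missed : forall v, v \in A ->
  exists2 M, is_matching_of_size E n M & v \notin cover M.

Lemma inseparable_sym u v : inseparable u v = inseparable v u.
Proof.
rewrite /inseparable eq_sym; congr (_ || ~~ _).
by apply: eq_existsb => M; rewrite [in RHS]andbCA andbA [in LHS]andbC andbA.
Qed.

Lemma inseparable_trans u v w : v \in A ->
  inseparable u v -> inseparable v w -> inseparable u w.
Proof.
move=> vA uv vw; rewrite /inseparable; case: (eqVneq u w) => //= uw.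
apply/negP=> /existsP[M /and3P[szM uM wM]].
have [N szN /andP[vN]] := missed_pair_split szM uw uM wM (all_missed vA).
case/orP=> zN.
  case/orP: uv => [/eqP uv|/existsP[]]; last by exists N; rewrite szN zN.
  subst v; case/orP: vw => [/eqP uw'|/existsP[]]; first by rewrite uw' eqxx in uw.
  by exists M; rewrite szM uM.
case/orP: vw => [/eqP vw|/existsP[]]; last by exists N; rewrite szN vN.
subst v; case/orP: uv => [/eqP uw'|/existsP[]]; first by rewrite uw' eqxx in uw.
by exists M; rewrite szM uM.
Qed.

Lemma inseparable_edge u v : [set u; v] \in E -> inseparable u v.
Proof.
move=> uvE; apply/orP; right; apply/negP=> /existsP[M /and3P[/andP[mM /eqP cM] uM vM]].
have [|m' uvM] := is_matchingU1 mM uvE.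
  by rewrite disjoint_set2 uM vM.
by have := matching_bound m'; rewrite cardsU1 uvM cM ltnn.
Qed.

(** Blocks are the classes of [inseparable].  An edge whose two ends are missed
    by a maximum matching would extend it, so edges stay inside blocks.  A
    maximum matching covers [2n] vertices and by definition misses at most one
    vertex per block, whence the bound on [#|A|]. *)
Lemma gallai_partition : exists P : {set {set T}},
  [/\ partition P A, #|A| <= 2 * n + #|P| &
      {in A &, forall u v, [set u; v] \in E -> v \in pblock P u}].
Proof.
have eqv : {in A & &, equivalence_rel inseparable}.
  move=> u v w uA vA wA; split=> [|uv]; first by rewrite /inseparable eqxx.
  apply/idP/idP; last exact: inseparable_trans vA uv.
  by apply: inseparable_trans uA _; rewrite inseparable_sym.
pose P := equivalence_partition inseparable A.
have partP : partition P A := equivalence_partitionP eqv.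
exists P; split=> // [|u v uA vA uvE]; last first.
  by rewrite pblock_equivalence_partition // inseparable_edge.
have [->|[v vA]] := set_0Vmem A; first by rewrite cards0.
have [M szM _] := all_missed vA; have [mM /eqP cM] := andP szM.
rewrite -cM -(card_cover_matching mM) -(cardsID (cover M) A).
apply: leq_add; first by rewrite subset_leq_card // subsetIr.
have inj : {in A :\: cover M &, injective (pblock P)}.
  move=> x y /setDP[xA xM] /setDP[yA yM] /eqP.
  rewrite eq_pblock ?(partition_trivIset partP) ?(cover_partition partP) //.
  rewrite pblock_equivalence_partition // => /orP[/eqP //|/existsP[]].
  by exists M; rewrite szM xM.
rewrite -(card_in_imset inj).
apply/subset_leq_card/subsetP=> X /imsetP[x /setDP[xA _] ->].
by apply: pblock_mem; rewrite (cover_partition partP).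
Qed.

End Gallai.

(** * Partitions covering all pairs *)

Lemma leq_card_bigcup (I T : finType) (P : pred I) (F : I -> {set T}) :
  #|\bigcup_(i | P i) F i| <= \sum_(i | P i) #|F i|.
Proof.
apply: (big_ind2 (fun (X : {set T}) s => #|X| <= s)) => [|X s Y s' Xs Ys|//].
  by rewrite cards0.
by apply: leq_trans (leq_add Xs Ys); case: (leq_card_setU X Y).
Qed.

Lemma sum_pred_card_partition (T : finType) (A : {set T}) (P : {set {set T}}) :
  partition P A -> \sum_(X in P) #|X|.-1 + #|P| = #|A|.
Proof.
move=> partP; rewrite (card_partition partP) -sum1_card -big_split /=.
apply: eq_bigr => X XP; rewrite addn1 prednK // card_gt0.
by apply: contraTneq XP => ->; case/and3P: partP.
Qed.

Lemma double_mul_leq_mul_pred (x y c : nat) :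
  x + y <= c -> 2 * (x * y) <= c * (x + y).-1.
Proof.
move=> le_c; apply: (@leq_trans ((x + y) * (x + y).-1)); last first.
  by rewrite leq_mul2r le_c orbT.
by case: x le_c => [|x] _; case: y => [|y]; rewrite ?muln0 ?addn0 //; nia.
Qed.

(** Let [C] be a largest block of all the partitions, occurring in [P i0].  The
    pairs with one end in [C] and the other in [A :\: C] are covered by the
    blocks [X] of the other partitions, where [X] covers
    [#|X :&: C| * #|X :\: C|] of them.  Since [#|X| <= #|C|], twice this number
    is at most [#|C| * (#|X| - 1)], and the [#|X| - 1] sum to at most [2 w_i]
    over [P i].  Dividing by [2 #|C|] bounds [#|A :\: C|] by the sum of the
    [w_i] with [i != i0]; the block [C] itself accounts for
    [#|C| - 1 <= 2 w_i0 <= w_i0 + K]. *)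
Lemma covering_partitions_bound (I T : finType) (A : {set T})
    (P : I -> {set {set T}}) (w : I -> nat) (K : nat) :
  (forall i, partition (P i) A) ->
  (forall i, #|A| <= 2 * w i + #|P i|) ->
  (forall i, w i <= K) ->
  {in A &, forall u v, u != v -> exists i, v \in pblock (P i) u} ->
  #|A| <= \sum_i w i + K + 1.
Proof.
move=> partP wP wK covP.
have [le1|/card_gt1P[u [v [uA vA uv]]]] := leqP #|A| 1.
  by rewrite addn1; apply: leq_trans le1 _.
have excess i : \sum_(X in P i) #|X|.-1 <= 2 * w i.
  by have := wP i; rewrite -(sum_pred_card_partition (partP i)) leq_add2r.
have [i1 _] := covP u v uA vA uv.
pose Q (p : I * {set T}) := p.2 \in P p.1.
have Q0 : Q (i1, pblock (P i1) u).
  by apply: pblock_mem; rewrite (cover_partition (partP i1)).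
case: (@arg_maxnP _ _ Q (fun p => #|p.2|) Q0) => -[i0 C]; rewrite /Q /= => CP maxC.
have CA : C \subset A by rewrite -(cover_partition (partP i0)) (bigcup_sup C).
have C0 : 0 < #|C|.
  by rewrite card_gt0; apply: contraTneq CP => ->; case/and3P: (partP i0).
have cardA : #|A| = #|C| + #|A :\: C| by rewrite -(cardsID C A) (setIidPr CA).
have crossing : setX C (A :\: C) \subset
    \bigcup_(i | i != i0) \bigcup_(X in P i) setX (X :&: C) (X :\: C).
  apply/subsetP=> -[x y] /setXP[xC /setDP[yA yC]].
  have xA := subsetP CA _ xC.
  have [|i xy] := covP x y xA yA; first by apply: contraNneq yC => <-.
  have covi : cover (P i) = A := cover_partition (partP i).
  apply/bigcupP; exists i.
    apply: contraNneq yC => ii0; subst i.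
    by rewrite -(def_pblock (partition_trivIset (partP i0)) CP xC).
  apply/bigcupP; exists (pblock (P i) x); first by rewrite pblock_mem ?covi.
  by rewrite !inE mem_pblock covi xA xC xy yC.
have key : 2 * (#|C| * #|A :\: C|) <= #|C| * (2 * \sum_(i | i != i0) w i).
  rewrite -cardsX; apply: (@leq_trans (2 * \sum_(i | i != i0)
      \sum_(X in P i) #|X :&: C| * #|X :\: C|)).
    rewrite leq_mul2l; apply: leq_trans (subset_leq_card crossing) _.
    apply: leq_trans (leq_card_bigcup _ _) _; apply: leq_sum => i _.
    apply: leq_trans (leq_card_bigcup _ _) _; apply: leq_sum => X _.
    by rewrite cardsX.
  rewrite !big_distrr /=; apply: leq_sum => i _.
  apply: (@leq_trans (#|C| * \sum_(X in P i) #|X|.-1)); last first.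
    by rewrite leq_mul2l excess orbT.
  rewrite !big_distrr /=; apply: leq_sum => X XP.
  rewrite -[in leqRHS](cardsID C X); apply: double_mul_leq_mul_pred.
  by rewrite cardsID; exact: (maxC (i, X)).
have CK : #|C|.-1 <= 2 * w i0.
  by apply: leq_trans (excess i0); rewrite (bigD1 C CP) leq_addr.
rewrite (bigD1 i0) //= cardA.
have : #|A :\: C| <= \sum_(i | i != i0) w i.
  by move: key; rewrite mulnCA leq_pmul2l // leq_pmul2l.
have := wK i0; lia.
Qed.

(** * The Cockayne-Lorimer theorem *)

(** The bounds [n] are separate for each color, and need not be attained, so
    that deleting a vertex may decrease one of them while [K] stays fixed. *)
Theorem cockayne_lorimer (I T : finType) (E : I -> {set {set T}})
    (A : {set T}) (n : I -> nat) (K : nat) :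
  (forall i e, e \in E i -> #|e| = 2) ->
  {in A &, forall u v, u != v -> exists i, [set u; v] \in E i} ->
  (forall i, n i <= K) ->
  (forall i M, is_matching (E i ::&: A) M -> #|M| <= n i) ->
  #|A| <= \sum_i n i + K + 1.
Proof.
move=> E2; have [s] := ubnP #|A|; elim: s => // s IHs in A n *.
rewrite ltnS => le_s covA nK bnd.
pose dec := [exists i, [exists (v | v \in A),
  [forall M, is_matching (E i ::&: (A :\ v)) M ==> (#|M| != n i)]]].
have subE i v M : is_matching (E i ::&: (A :\ v)) M -> is_matching (E i ::&: A) M.
  case/andP=> sM trM; rewrite /is_matching trM andbT; apply: subset_trans sM _.
  by apply/subsetP=> e; rewrite !inE => /andP[-> /subset_trans->] //; exact: subsetDl.
case: (boolP dec) => [/existsP[i /exists_inP[v vA /forallP small]] | hard].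
  have small' M : is_matching (E i ::&: (A :\ v)) M -> #|M| < n i.
    move=> mM; rewrite ltn_neqAle (bnd _ _ (subE _ _ _ mM)) andbT.
    exact: (implyP (small M)).
  have n0 : 0 < n i.
    apply: leq_ltn_trans (small' set0 _) => //.
    rewrite /is_matching sub0set; apply/trivIsetP=> B C; by rewrite inE.
  pose n' j := n j - (j == i).
  have cA := cardsD1 v A; rewrite vA in cA.
  have sum' : \sum_j n j = \sum_j n' j + 1.
    rewrite (bigD1 i) //= [in RHS](bigD1 i) //= {1}/n' eqxx subn1.
    rewrite addnAC addn1 prednK //; congr (_ + _).
    by apply: eq_bigr => j /negPf ji; rewrite /n' ji subn0.
  have nK' j : n' j <= K by apply: leq_trans (nK j); exact: leq_subr.
  rewrite sum'; suff: #|A :\ v| <= \sum_j n' j + K + 1 by lia.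
  apply: IHs => //; first by lia.
    by move=> x y /setD1P[_ xA] /setD1P[_ yA]; apply: covA.
  move=> j M mM; rewrite /n'; case: (eqVneq j i) => [ji|_]; last first.
    by rewrite subn0 (bnd _ _ (subE _ _ _ mM)).
  by subst j; have := small' M mM; lia.
(* No deletion helps: after deleting any [v] from [A], every color [i] still has
   a matching with [n i] edges. *)
have missed i v : v \in A ->
    exists2 M, is_matching_of_size (E i ::&: A) (n i) M & v \notin cover M.
  move=> vA; move: hard; rewrite negb_exists => /forallP/(_ i).
  rewrite negb_exists => /forallP/(_ v); rewrite vA negb_forall => /existsP[M].
  rewrite negb_imply negbK => /andP[mM cM]; exists M.
    by rewrite /is_matching_of_size (subE _ _ _ mM).
  apply/bigcupP=> -[e eM ve]; have /andP[/subsetP/(_ e eM)] := mM.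
  by rewrite !inE => /andP[_ /subsetP/(_ v ve)]; rewrite !inE eqxx.
have E2A i e : e \in E i ::&: A -> #|e| = 2 by rewrite inE => /andP[/E2].
have /fin_all_exists[P HP] i := gallai_partition (E2A i) (bnd i) (missed i).
apply: (@covering_partitions_bound _ _ A P) => //; try by move=> i; case: (HP i).
move=> u v uA vA uv; have [i uvE] := covA u v uA vA uv; exists i.
case: (HP i) => _ _; apply=> //; rewrite inE uvE /=.
by rewrite subUset !sub1set uA.
Qed.

(** * The upper bound *)

Lemma matching_copy (r k t : nat) (hr : 2 <= r) (hk : 1 <= k) (H : hypergraph)
    (E : 'I_t -> {set {set H}}) (i : 'I_t) (g : 'I_k -> {set H}) :
  (forall j, g j \in E i) -> (forall j, #|g j| = r) ->
  (forall j j' x, x \in g j -> x \in g j' -> j = j') ->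
  monochromatic_copy (matching hr hk) E.
Proof.
move=> gE cg disj; exists i.
pose f (p : 'I_k * 'I_r) : H := enum_val (cast_ord (esym (cg p.1)) p.2).
have fg p : f p \in g p.1 by exact: enum_valP.
exists f; split.
  move=> p q fpq; have e1 : p.1 = q.1 by apply: disj (fg p) _; rewrite fpq.
  case: p q e1 fpq => [j a] [j' b] /= e1; subst j'.
  by rewrite /f /= => /enum_val_inj/cast_ord_inj ->.
apply/subsetP=> _ /imsetP[_ /imsetP[j _ ->] ->].
suff -> : f @: matching_edge r j = g j by exact: gE.
apply/setP=> x; apply/imsetP/idP=> [[p]|xg].
  by rewrite inE => /eqP <- ->; exact: fg.
exists (j, cast_ord (cg j) (enum_rank_in xg x)); first by rewrite inE.
by rewrite /f /= cast_ordK enum_rankK_in.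
Qed.

(** Recoloring the class [b] by [a] uses one color fewer than the chromatic
    number, so it creates a monochromatic edge.  That edge was not monochromatic
    under [c], which leaves only the color set [{a, b}]. *)
Lemma chromatic_class_pair_edge (H : hypergraph) (m : nat) (c : H -> 'I_m)
    (a b : 'I_m) :
  chromatic H m -> proper_coloring c -> a != b ->
  exists2 h, h \in edges H & c @: h = [set a; b].
Proof.
case: m c a b => [|m] c a b [_ minm] propc ab; first by case: a {ab}.
have [j0 aE] : exists j0, a = lift b j0.
  by case: (unliftP b a) ab => [j ->|->] ab; [exists j | rewrite eqxx in ab].
case: (boolP [exists h in edges H, c @: h == [set a; b]]).
  by case/exists_inP=> h hE /eqP; exists h.
move=> none; exfalso; have : m.+1 <= m; last by rewrite ltnn.
apply: minm; split; first by case: (m) j0 {aE} => // -[].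
(* [unlift b] renumbers the colors other than [b]; [j0] is the new name of
   [a], and also the default given to the vertices of color [b]. *)
exists (fun x => odflt j0 (unlift b (c x))) => e eE [j mono].
have two x : x \in e -> c x = lift b j \/ (c x = b /\ j = j0).
  by move=> /mono; case: unliftP => [j' -> /= ->|-> /= ->]; [left | right].
have [ej|jj0] := eqVneq j j0; last first.
  apply: (propc e eE); exists (lift b j) => x /two[//|[_ /eqP]].
  by rewrite (negPf jj0).
subst j; rewrite -aE in two.
case/negP: none; apply/exists_inP; exists e => //.
have hit z z' : (forall x, x \in e -> c x = z \/ c x = z') -> z' \in c @: e.
  move=> zz'; apply/negPn/negP=> z'N; apply: (propc e eE); exists z => x xe.
  by case: (zz' x xe) => // cx; rewrite -cx imset_f in z'N.
rewrite eqEsubset subUset !sub1set (hit b a) ?(hit a b) ?andbT //.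
- by apply/subsetP=> _ /imsetP[x /two[->|[-> _]] ->]; rewrite !inE eqxx ?orbT.
- by move=> x /two[|[]]; [left | right].
- by move=> x /two[|[]]; [right | left].
Qed.

(** A matching in the complete graph on the classes of a proper coloring [c]
    lifts to [H]: two edges of [H] with a common vertex [x] have color sets with
    the common element [c x]. *)
Lemma ramsey_property_matching (r k t : nat) (hr : 2 <= r) (hk : 1 <= k) :
  1 <= t -> ramsey_property r (matching hr hk) t ((t - 1) * (k - 1) + 2 * k).
Proof.
set m := _ + _ => ht H unifH chrH E [EH _].
have [[_ [c propc]] _] := chrH.
pose EC i : {set {set 'I_m}} :=
  [set e in [set c @: h | h : {set H} in E i] | #|e| == 2].
case: (boolP [exists i, [exists M, is_matching (EC i) M && (k <= #|M|)]]); last first.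
  move=> none; suff : m <= (\sum_(i < t) (k - 1)) + (k - 1) + 1.
    by rewrite sum_nat_const card_ord /m; nia.
  rewrite -[m in m <= _]card_ord -cardsT.
  apply: (@cockayne_lorimer _ _ EC) => //.
  - by move=> i e; rewrite inE => /andP[_ /eqP].
  - move=> a b _ _ ab; have [h hE hab] := chromatic_class_pair_edge chrH propc ab.
    move: hE; rewrite -EH => /bigcupP[i _ hi]; exists i.
    by rewrite inE cards2 ab andbT -hab imset_f.
  - move=> i M mM; rewrite leqNgt; apply/negP=> big; case/negP: none.
    apply/existsP; exists i; apply/existsP; exists M; apply/andP; split; last by lia.
    case/andP: mM => sM trM; rewrite /is_matching trM andbT; apply: subset_trans sM _.
    by apply/subsetP=> e; rewrite inE => /andP[].
case/existsP=> i /existsP[M /andP[mM kM]].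
(* [set0] is a dummy: an [e] in [M] always comes from an edge in [E i]. *)
pose h (e : {set 'I_m}) : {set H} := odflt set0 [pick h in E i | c @: h == e].
have hP e : e \in M -> h e \in E i /\ c @: h e = e.
  move=> eM; have := subsetP (andP mM).1 e eM.
  rewrite inE => /andP[/imsetP[h0 h0E eh0] _].
  rewrite /h; case: pickP => [h1 /andP[? /eqP]//|/(_ h0)].
  by rewrite h0E eh0 eqxx.
pose e (j : 'I_k) : {set 'I_m} := enum_val (widen_ord kM j).
have eM j : e j \in M by exact: enum_valP.
apply: (@matching_copy _ _ _ _ _ _ _ i (h \o e)) => [j|j|j j' x /= xj xj'].
- by case: (hP _ (eM j)).
- apply: unifH; rewrite -EH; apply/bigcupP; exists i => //.
  by case: (hP _ (eM j)).
have /enum_val_inj/(congr1 val)/= : e j = e j'; last exact: val_inj.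
apply: (@edges_meet_eq _ _ _ _ _ (c x) mM) => //.
- by case: (hP _ (eM j)) => _ <-; rewrite imset_f.
- by case: (hP _ (eM j')) => _ <-; rewrite imset_f.
Qed.

(** * The lower bound for graphs *)

Fact complete_graph_nonempty (n : nat) : 1 <= n -> 1 <= #|'I_n|.
Proof. by rewrite card_ord. Qed.

Fact complete_graph_ge2 (n : nat) (e : {set 'I_n}) :
  e \in [set e : {set 'I_n} | #|e| == 2] -> 2 <= #|e|.
Proof. by rewrite inE => /eqP->. Qed.

Definition complete_graph (n : nat) (hn : 1 <= n) : hypergraph :=
  Hypergraph (complete_graph_nonempty hn) (@complete_graph_ge2 n).

Lemma chromatic_complete_graph (n : nat) (hn : 1 <= n) :
  chromatic (complete_graph hn) n.
Proof.
split=> [|n' [_ [c propc]]].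
  split=> //; exists id => e; rewrite inE => /cards2P[x [y [xy ->]]] [z mono].
  case/eqP: xy; apply: etrans (mono x _) (esym (mono y _));
    by rewrite !inE eqxx ?orbT.
have inj : injective c.
  move=> x y cxy; apply/eqP/negPn/negP=> xy; apply: (propc [set x; y]).
    by rewrite inE cards2 xy.
  by exists (c y) => z; rewrite !inE => /orP[]/eqP->.
by have := leq_card c inj; rewrite !card_ord.
Qed.

(** On vertices [0, ..., n - 1] the edge with larger end [z] gets color
    [(z - k) / (k - 1)].  Truncated subtraction makes this 0 exactly for
    [z < 2k - 1] when [k >= 2], and color [i > 0] consists of the [k - 1] values
    of [z] from [k + i (k - 1)] on.  When [k = 1] the quotient is a division by
    zero, hence 0, and [n < 2] leaves a single vertex, in agreement with
    [z < 2k - 1]. *)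
Lemma ramsey_property_matching2_ge (k t n : nat) (hr : 2 <= 2) (hk : 1 <= k) :
  1 <= t -> 1 <= n -> ramsey_property 2 (matching hr hk) t n ->
  (t - 1) * (k - 1) + 2 * k <= n.
Proof.
move=> ht hn ram; rewrite leqNgt; apply/negP=> small.
pose col z := (z - k) %/ (k - 1).
have col_lt z : z < n -> col z < t.
  rewrite /col => zn; case: (posnP (k - 1)) => [->|k1]; first by rewrite divn0.
  by rewrite ltn_divLR //; nia.
pose top (e : {set 'I_n}) := \max_(x in e) val x.
have top_lt e : top e < n.
  apply: (@leq_ltn_trans n.-1); last by rewrite prednK.
  by rewrite /top; apply/bigmax_leqP=> x _; rewrite -ltnS prednK ?ltn_ord.
pose E (i : 'I_t) : {set {set complete_graph hn}} :=
  [set e : {set 'I_n} | (#|e| == 2) && (col (top e) == i)].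
have colE : edge_coloring E.
  split=> [|i j ij].
    apply/setP=> e; rewrite inE; apply/bigcupP/idP=> [[i _]|e2].
      by rewrite inE => /andP[].
    by exists (Ordinal (col_lt _ (top_lt e))); rewrite // inE e2 /=.
  rewrite disjoint_subset; apply/subsetP=> e; rewrite !inE => /andP[-> /eqP->] /=.
  by rewrite val_eqE.
have unif : uniform 2 (complete_graph hn) by move=> e; rewrite inE => /eqP.
have [i [f [injf /subsetP fE]]] := ram _ unif (chromatic_complete_graph hn) E colE.
pose a (j : 'I_k) := top (f @: matching_edge 2 j).
have col_a j : col (a j) = i.
  have : f @: matching_edge 2 j \in E i by apply/fE/imset_f/imset_f.
  by rewrite inE => /andP[_ /eqP].
have f_le p : f p <= a p.1.
  rewrite /a /top; apply: (@leq_bigmax_cond _ _ (fun x : 'I_n => val x)).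
  by apply: imset_f; rewrite inE.
have a_f j : exists2 p, p.1 = j & a j = f p.
  have [|x /imsetP[p pj ->]] := @eq_bigmax_cond _ (mem (f @: matching_edge 2 j))
    (fun x : 'I_n => val x).
    by rewrite card_imset // card_matching_edge.
  by exists p => //; apply/eqP; move: pj; rewrite inE.
have inj_a : injective a.
  move=> j j'; have [p <- ->] := a_f j; have [q <- ->] := a_f j'.
  by move=> /val_inj/injf ->.
case: (posnP i) => [i0|i_gt0].
  (* Color 0: the whole copy, with [2 * k] vertices, lies below [2 * k - 1]. *)
  have a_lt j : a j < 2 * k - 1.
    have := col_a j; have := top_lt (f @: matching_edge 2 j); rewrite -/(a j) i0 /col.
    case: (posnP (k - 1)) => [k1 an _|k1 an /eqP].
      by move: small; rewrite k1; lia.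
    by rewrite -leqn0 leqNgt divn_gt0 // -ltnNge; lia.
  have injF : injective (fun p => Ordinal (leq_ltn_trans (f_le p) (a_lt p.1))).
    by move=> p q /(congr1 val)/= /val_inj/injf.
  by have := leq_card _ injF; rewrite card_prod !card_ord; lia.
(* Color [i > 0]: the [k] larger ends are distinct and share an interval of
   length [k - 1]. *)
have k1 : 0 < k - 1.
  case: (posnP (k - 1)) => // k1; have := col_a (Ordinal hk).
  by rewrite /col k1 divn0 => i0; rewrite -i0 in i_gt0.
have a_btw j : i * (k - 1) + k <= a j /\ a j - (i * (k - 1) + k) < k - 1.
  have := col_a j; rewrite /col => ai.
  have := divn_eq (a j - k) (k - 1); have := ltn_pmod (a j - k) k1.
  by rewrite ai; nia.
have injF : injective (fun j => Ordinal (a_btw j).2).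
  move=> j j' /(congr1 val)/= ajj'; apply: inj_a.
  by have := (a_btw j).1; have := (a_btw j').1; lia.
by have := leq_card _ injF; rewrite !card_ord; lia.
Qed.

(** * The chromatic Ramsey number of a matching *)

(** Classical, because [P] will be the Ramsey property, which quantifies over all
    hypergraphs. *)
Lemma least_exists (P : nat -> Prop) (n : nat) :
  P n -> exists m, least P m /\ m <= n.
Proof.
elim/ltn_ind: n => n IHn Pn.
have [[n' [ltn Pn']]|none] := classic (exists n', n' < n /\ P n').
  by have [m [lm mn']] := IHn n' ltn Pn'; exists m; split=> //; lia.
exists n; split=> //; split=> // n' Pn'; rewrite leqNgt; apply/negP=> n'n.
by apply: none; exists n'.
Qed.

Theorem theorem4 (r k t : nat) (hr : 2 <= r) (hk : 1 <= k) (ht : 1 <= t) :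
  (exists m : nat, chromatic_ramsey r (matching hr hk) t m
     /\ m <= (t - 1) * (k - 1) + 2 * k)
  /\ (r = 2 ->
      chromatic_ramsey r (matching hr hk) t ((t - 1) * (k - 1) + 2 * k)).
Proof.
have upper : 1 <= (t - 1) * (k - 1) + 2 * k /\
    ramsey_property r (matching hr hk) t ((t - 1) * (k - 1) + 2 * k).
  by split; [nia | exact: ramsey_property_matching].
split=> [|r2]; first exact: least_exists upper.
subst r; split=> // n [hn]; exact: ramsey_property_matching2_ge.
Qed.
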